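(* Every H-closed Hausdorff space is $\chi$-Lindelöf.
   Context: All spaces are assumed to be Hausdorff. A space $X$ is H-closed if every open cover $\mathcal{V}$ of $X$ has a finite subfamily $\mathcal{W}$ such that $X=\overline{\bigcup\mathcal{W}}$. The character $\chi(X)$ of a space $X$ is the smallest infinite cardinal $\kappa$ such that every point of $X$ has a local base of cardinality not exceeding $\kappa$. $[S]^{<\omega}$ denotes the collection of all finite subsets of $S$, and $\overline{B}$ denotes the closure of $B$ in $X$. ''Countable'' means of cardinality at most $\omega$. For a cardinal $\kappa$, a $\kappa$-net in $X$ is an indexed family $\xi=\{x_F:F\in[\kappa]^{<\omega}\}$ of points of $X$ (indexed by the finite subsets of $\kappa$; repetitions allowed). We write $\xi\subseteq A$ if $x_F\in A$ for all $F$. Let $A\subseteq X$ and let $\xi=\{x_F:F\in[\kappa]^{<\omega}\}\subseteq A$ be a $\kappa$-net. A point $x\in A$ is a $\theta$-cluster point of $\xi$ relative to $A$ if, for every open set $U$ of $X$ with $x\in U$ and every $\alpha<\kappa$, there exists $F\in[\kappa]^{<\omega}$ such that $\alpha\in F$ and $x_F\in\overline{U\cap A}$. If $A=X$, we say that $x$ is a $\theta$-cluster point of $\xi$ (in $X$). A set $A\subseteq X$ is $\chi$-net-closed if for every $\chi(X)$-net $\xi=\{x_F:F\in[\chi(X)]^{<\omega}\}\subseteq A$: if $\xi$ has a $\theta$-cluster point in $X$, then $\xi$ has a $\theta$-cluster point in $A$ relative to $A$. A space $X$ is $\chi$-Lindelöf if for every $\chi$-net-closed set $A\subseteq X$ and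 every collection $\mathcal{U}=\bigcup\{\mathcal{U}_\alpha:\alpha<\chi(X)\}$ of open sets in $X$ which covers $A$ (presented as a union of subcollections $\mathcal{U}_\alpha$), there are countable subcollections $\mathcal{V}_\alpha\subseteq\mathcal{U}_\alpha$ for each $\alpha<\chi(X)$ such that $A\subseteq\bigcup\{\overline{\bigcup\mathcal{V}_\alpha}:\alpha<\chi(X)\}$. *)

(* Defs.v *)
From mathcomp Require Import all_boot finmap.
From mathcomp Require Import all_classical.
From mathcomp Require Import topology.

Set Implicit Arguments.
Unset Strict Implicit.
Unset Printing Implicit Defensive.

Local Open Scope classical_set_scope.
Local Open Scope card_scope.

Definition H_closed (X : topologicalType) : Prop :=
  forall V : set (set X),
    (forall U, V U -> open U) -> \bigcup_(U in V) U = [set: X] ->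
    exists W : set (set X),
      [/\ W `<=` V, finite_set W & closure (\bigcup_(U in W) U) = [set: X]].

Definition local_base (X : topologicalType) (x : X) (B : set (set X)) : Prop :=
  B `<=` open_nbhs x /\
  forall U, nbhs x U -> exists2 V, B V & V `<=` U.

Definition has_local_bases (X : topologicalType) (K : Type) : Prop :=
  forall x : X, exists2 B, local_base x B & B #<= [set: K].

(* Cardinals are represented by types, up to equipotence: nets use only
   membership of an index in a finite set of indices, so the well-order of an
   initial ordinal plays no role. *)
Definition is_character (X : topologicalType) (K : Type) : Prop :=
  [/\ infinite_set [set: K], has_local_bases X K
    & forall L : Type, infinite_set [set: L] -> has_local_bases X L ->
        [set: K] #<= [set: L]].

(* Project from a maximal set of sections on which all projections are
   injective: some projection is onto. *)
Lemma exists_min_card (I : Type) (S : I -> Type) :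
  I -> exists i, forall j, [set: S i] #<= [set: S j].
Proof.
move=> i0.
pose P (A : set (forall i, S i)) :=
  forall i f g, A f -> A g -> f i = g i -> f = g.
have [|A [PA maxA]] := @Zorn_bigcup _ P.
  move=> F FP totF i f g [B FB Bf] [C FC Cg].
  have [BC|CB] := totF _ _ FB FC.
  - by apply: (FP _ FC i) => //; exact: BC.
  - by apply: (FP _ FB i) => //; exact: CB.
have [i Ai] : exists i, forall s : S i, exists2 f, A f & f i = s.
  apply: contrapT => nA.
  have miss i : {s : S i | forall f, A f -> f i <> s}.
    apply: cid; apply: contrapT => ns; apply: nA; exists i => s.
    apply: contrapT => nf; apply: ns; exists s => f Af fs.
    by apply: nf; exists f.
  pose g i := sval (miss i).
  have gP i f : A f -> f i <> g i by rewrite /g; case: (miss i) => /= s; apply.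
  apply: (maxA (A `|` [set g])).
    split; first by move=> f Af; left.
    by move=> /(_ g (or_intror erefl)) Ag; exact: (gP i0 g Ag).
  move=> i f h [Af|->] [Ah|->] //.
  - exact: PA.
  - by move=> /(gP i f Af).
  - by move=> /esym /(gP i h Ah).
exists i => j.
have -> : [set: S i] = (fun f : forall i, S i => f i) @` A.
  by rewrite eqEsubset; split => // s _; have [f Af fs] := Ai s; exists f.
apply: card_le_trans (card_image_le _ _) _.
have injA : {in A &, injective (fun f : forall i, S i => f j)}.
  by move=> f h /set_mem Af /set_mem Ah; exact: PA.
by rewrite -(card_le_eql (inj_card_eq injA)); exact: card_leT.
Qed.

Lemma character_exists (X : topologicalType) :
  exists K : choiceType, is_character X K.
Proof.
pose T := (set X + nat)%type.
have infT : infinite_set [set: T].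
  apply/infiniteP.
  have inrI : {in [set: nat] &, injective (@inr (set X) nat)}.
    by move=> m n _ _ [].
  by rewrite -(card_le_eql (inj_card_eq inrI)); exact: card_leT.
have lbT : has_local_bases X T.
  move=> x; exists (open_nbhs x).
    by split=> // U; rewrite nbhsE => -[V xV VU]; exists V.
  have inlI : {in (open_nbhs x : set (set X)) &, injective (@inl (set X) nat)}.
    by move=> U V _ _ [].
  by rewrite -(card_le_eql (inj_card_eq inlI)); exact: card_leT.
pose good (S : set T) := infinite_set S /\
  forall x : X, exists2 B, local_base x B & B #<= S.
have goodT : good [set: T] by [].
have [[S [infS lbS]] minS] := @exists_min_card {S : set T | good S}
  (fun S => set_type (sval S)) (exist _ _ goodT).
have minS' (S' : set T) : good S' -> S #<= S'.
  move=> gS'; have := minS (exist _ _ gS') => /=.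
  by rewrite (card_le_eql (card_setT _)) (card_le_eqr (card_setT _)).
exists ({classic set_type S}); split.
- by rewrite (eq_finite_set (card_setT S)).
- move=> x; have [B xB BS] := lbS x; exists B => //.
  by rewrite (card_le_eqr (card_setT S)).
- move=> L infL lbL; rewrite (card_le_eql (card_setT S)).
  have [[] minTL] := @exists_min_card bool (fun b => if b then L else T) true.
  + have /card_subP[C CL _] := minTL false.
    rewrite -(card_le_eqr CL); apply: minS'; split.
      by rewrite (eq_finite_set CL).
    move=> x; have [B xB BL] := lbL x; exists B => //.
    by rewrite (card_le_eqr CL).
  + exact: card_le_trans (card_leT _) (minTL true).
Qed.

Definition character (X : topologicalType) : choiceType :=
  sval (cid (character_exists X)).

Lemma characterP (X : topologicalType) : is_character X (character X).
Proof. exact: svalP (cid (character_exists X)). Qed.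

Definition net (X : topologicalType) (K : choiceType) : Type := {fset K} -> X.

Definition theta_cluster_point (X : topologicalType) (K : choiceType)
    (A : set X) (xi : net X K) (x : X) : Prop :=
  A x /\ forall U, open U -> U x -> forall a : K,
    exists2 F : {fset K}, a \in F & closure (U `&` A) (xi F).

Definition chi_net_closed (X : topologicalType) (A : set X) : Prop :=
  forall xi : net X (character X), (forall F, A (xi F)) ->
    (exists x, theta_cluster_point [set: X] xi x) ->
    exists x, theta_cluster_point A xi x.

Definition chi_Lindelof (X : topologicalType) : Prop :=
  forall (A : set X) (U : character X -> set (set X)),
    chi_net_closed A ->
    (forall a O, U a O -> open O) ->
    A `<=` \bigcup_a \bigcup_(O in U a) O ->
    exists V : character X -> set (set X),
      (forall a, V a `<=` U a /\ countable (V a)) /\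
      A `<=` \bigcup_a closure (\bigcup_(O in V a) O).

(* Main.v *)
Require Import Defs.
From mathcomp Require Import all_boot finmap.
From mathcomp Require Import all_classical.
From mathcomp Require Import topology.

(** The conclusion holds in a stronger form: in an H-closed Hausdorff space a
    chi-net-closed set [A] is an H-set, that is, any open cover of [A] has a
    finite subfamily whose closures cover [A]
    ([chi_net_closed_finite_subcover]).  Intersecting that finite subfamily
    with each [U a] then gives the countable (indeed finite) [V a].

    To use H-closedness of the whole space, every point [p] of [X], inside or
    outside [A], needs a neighbourhood, and the difficulty is that [A] need not
    be theta-closed: for [p] outside [A] the closures of all neighbourhoods of
    [p] may meet [A].  They can only do so in small sets, however.  Say that [O]
    traps [B] on [A] when any relatively open piece of [A] lying in the closure
    of [B] lies in the closure of [O].  If [p] is in [A] and [O] is an open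
    neighbourhood of [p], then some neighbourhood of [p] is trapped by [O]; if
    [p] is not in [A], some neighbourhood of [p] is trapped by the empty set, so
    that its closure has empty interior relative to [A].  This is
    [trapped_nbhs], the only place where nets are used: otherwise the pieces
    escaping [O], taken for the finite intersections from a local base at [p],
    contain the points of a net that has the theta-cluster point [p], but whose
    theta-cluster points relative to [A] could only be [p], which is either
    outside [A] or separated from the net by [O].

    By H-closedness, finitely many trapped neighbourhoods have dense union.
    Their closures are finitely many closed sets covering [A], so any nonempty
    relatively open piece of [A] contains a smaller one inside a single such
    closure ([open_piece_in_closure]), and that one is inside the closure of the
    corresponding [O].  Hence no piece of [A] avoids all the closures of the
    finitely many sets [O]. *)

Set Implicit Arguments.
Unset Strict Implicit.
Unset Printing Implicit Defensive.

Local Open Scope classical_set_scope.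
Local Open Scope card_scope.

Definition trapped (X : topologicalType) (A O B : set X) : Prop :=
  forall G, open G -> G `&` A `<=` closure B -> G `&` A `<=` closure O.

Lemma local_base_enum (X : topologicalType) (K : Type) (x : X) :
  has_local_bases X K ->
  exists b : K -> set X, (forall k, open_nbhs x (b k)) /\
    forall U, nbhs x U -> exists k, b k `<=` U.
Proof.
move=> /(_ x)[B [Bx Bbase] BK].
(* A local base is nonempty: [V0] is the value of the enumeration at the
   indices that the surjection sends outside [B]. *)
have [V0 BV0 _] := Bbase setT filterT.
have [f fB] : exists f : K -> set X, B `<=` range f.
  by have /pcard_surjP[f] := BK; exists f.
exists (fun k => if pselect (B (f k)) then f k else V0); split.
  by move=> k; case: pselect => [Bk|nBk]; exact: Bx.
move=> U /Bbase[V BV VU].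
have [k _ fk] := fB V BV.
by exists k; case: pselect; rewrite fk.
Qed.

(** A theta-cluster point of the escaping net relative to [A] is in the closure
    of every basic neighbourhood of [p], because the pieces around the points of
    the net are; in a Hausdorff space only [p] itself is in all of them. *)
Lemma trapped_nbhs (X : topologicalType) (A O : set X) (p : X) :
  hausdorff_space X -> chi_net_closed A -> open O -> (A p -> O p) ->
  exists2 B, open_nbhs p B & trapped A O B.
Proof.
move=> hX cA oO pO; apply: contrapT => noB.
have [_ lb _] := characterP X.
have [b [bp bbase]] := local_base_enum p lb.
pose I (F : {fset character X}) := \bigcap_(k in [set` F]) b k.
have Ip F : open_nbhs p (I F).
  split; last by move=> k _; have [] := bp k.
  rewrite -closedC setC_bigcap; apply: closed_bigcup => [|k _].
    exact: finite_fset.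
  by apply: open_closedC; have [] := bp k.
have esc F : exists zG : X * set X,
    [/\ open zG.2, zG.2 `&` A `<=` closure (I F),
        (zG.2 `&` A) zG.1 & ~ closure O zG.1].
  apply: contrapT => no; apply: noB; exists (I F) => // G oG GI z Gz.
  by apply: contrapT => nOz; apply: no; exists (z, G).
have [zG zGP] := choice esc.
pose xi : net X (character X) := fun F => (zG F).1.
have [||y [Ay cy]] := cA xi.
- by move=> F; have [_ _ []] := zGP F.
- (* The net has the theta-cluster point [p], since x_F is in the closure of
     the basic neighbourhood [b k] as soon as [F] contains [k]. *)
  exists p; split=> // U oU Up a.
  have [k kU] := bbase U (open_nbhs_nbhs (conj oU Up)).
  exists [fset a; k]%fset; first by rewrite !inE eqxx.
  have [_ sub Gz _] := zGP [fset a; k]%fset.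
  apply: closure_subset (sub _ Gz) => x /(_ k) bx.
  by rewrite setIT; apply: kU; apply: bx; rewrite /= !inE eqxx orbT.
have yp : y = p.
  apply: contrapT => /eqP ynp.
  have := hX; rewrite open_hausdorff.
  move=> /(_ y p ynp)[[P Q] /= [/set_mem Py /set_mem Qp] [oP oQ PQ0]].
  have [k kQ] := bbase Q (open_nbhs_nbhs (conj oQ Qp)).
  have [F kF clz] := cy P oP Py k.
  have [oG sub [Gz _] _] := zGP F.
  (* Here it matters that theta-clustering is relative to [A]: [P] meets the
     piece of [A] around x_F, not merely an open set around x_F. *)
  have [w [[Pw Aw] Gw]] := clz _ (open_nbhs_nbhs (conj oG Gz)).
  have [v [Iv Pv]] := sub w (conj Gw Aw) _ (open_nbhs_nbhs (conj oP Pw)).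
  have : (P `&` Q) v by split=> //; apply: kQ; exact: Iv.
  by rewrite (eqP PQ0).
move: Ay cy; rewrite yp => Ap cp.
have [k _] := bbase setT filterT.
have [F _ clz] := cp O oO (pO Ap) k.
by have [_ _ _ []] := zGP F; apply: closure_subset clz; exact: subIsetl.
Qed.

(** If a piece is not inside the closure of the first set of the list, removing
    that closure leaves a nonempty piece, which the other sets still cover up to
    closure because it is open and misses the first one. *)
Lemma open_piece_in_closure (X : topologicalType) (A G : set X)
    (s : seq (set X)) :
  open G -> G `&` A !=set0 ->
  G `<=` closure (\bigcup_(B in [set` s]) B) ->
  exists2 B, B \in s & exists H,
    [/\ open H, H `<=` G, H `&` A !=set0 & H `&` A `<=` closure B].
Proof.
elim: s G => [|B s IHs] G oG GA0 Gs.
  have [z [Gz _]] := GA0.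
  by have [w [[C Cs]]] := Gs z Gz _ (open_nbhs_nbhs (conj oG Gz)).
have [GB|] := pselect (G `&` A `<=` closure B).
  by exists B; [rewrite mem_head|exists G; split].
move=> /existsNP[z /not_implyP[[Gz Az] nBz]].
have oC : open (G `&` ~` closure B).
  by apply: openI => //; apply: closed_openC; exact: closed_closure.
have [||C Cs [H [oH HG HA HC]]] := IHs _ oC; first by exists z.
  move=> x [Gx nBx] N Nx.
  have /(Gs x Gx)[w [[D Ds Dw] [Nw [Gw nBw]]]] :
      nbhs x (N `&` (G `&` ~` closure B)).
    by apply: filterI => //; exact: open_nbhs_nbhs.
  exists w; split=> //; exists D => //.
  move: Ds; rewrite /= inE => /orP[/eqP DB|//].
  by case: nBw; apply: subset_closure; rewrite -DB.
exists C; first by rewrite inE Cs orbT.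
by exists H; split=> // x /HG[].
Qed.

(** The sets [B] below are the trapped neighbourhoods; those taken around points
    outside [A] are trapped by the empty set, which need not be in the cover,
    hence the alternative in the choice of [O]. *)
Lemma chi_net_closed_finite_subcover (X : topologicalType) (A : set X)
    (U : set (set X)) :
  hausdorff_space X -> H_closed X -> chi_net_closed A ->
  U `<=` open -> A `<=` \bigcup_(O in U) O ->
  exists W, [/\ W `<=` U, finite_set W & A `<=` \bigcup_(O in W) closure O].
Proof.
move=> hX cX cA oU AU.
pose good (B O : set X) := (U O \/ O = set0) /\ trapped A O B.
have [||N [NV /finite_seqP[s Ns] Ndense]] :=
  cX [set B | open B /\ exists O, good B O].
- by move=> B [].
- rewrite -subTset => p _.
  have [O [UO oO pO]] : exists O, [/\ U O \/ O = set0, open O & A p -> O p].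
    have [Ap|nAp] := pselect (A p).
      have [O UO Op] := AU p Ap.
      by exists O; split=> //; [left|exact: oU].
    by exists set0; split=> //; [right|exact: open0].
  have [B [oB Bp] trB] := trapped_nbhs hX cA oO pO.
  by exists B => //; split=> //; exists O.
have /choice[o oP] : forall B, exists O, N B -> good B O.
  move=> B; have [/NV[_ [O gO]]|nB] := pselect (N B); first by exists O.
  by exists set0.
exists ((o @` N) `&` U); split; first exact: subIsetr.
  by apply: finite_setIl; apply: finite_image; rewrite Ns; exact: finite_seq.
have subW B : N B -> closure (o B) `<=` \bigcup_(O in (o @` N) `&` U) closure O.
  move=> NB x xB; have [[UoB|oB0] _] := oP B NB.
    by exists (o B) => //; split=> //; exists B.
  by move: xB; rewrite oB0 closure0.
move=> z Az; apply: contrapT => nz.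
pose C := \bigcup_(B in N) closure (o B).
have oC : open (~` C).
  apply: closed_openC; apply: closed_bigcup.
    by rewrite Ns; exact: finite_seq.
  by move=> B _; exact: closed_closure.
have zC : (~` C) z by move=> [B NB zB]; apply: nz; exact: subW zB.
have [||B Bs [H [oH HC [w Hw] HB]]] := @open_piece_in_closure X A (~` C) s oC.
- by exists z.
- by rewrite -Ns Ndense.
have NB : N B by rewrite Ns.
have [_ trB] := oP B NB.
by have [Hw' _] := Hw; apply: (HC w Hw'); exists B => //; exact: (trB H).
Qed.

Theorem proposition9 (X : topologicalType) (hX : hausdorff_space X)
  (cX : H_closed X) : chi_Lindelof X.
Proof.
move=> A U cA oU AU.
have [||W [WU finW AW]] :=
    @chi_net_closed_finite_subcover X A (\bigcup_a U a) hX cX cA.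
- by move=> O [a _ /oU].
- by move=> x /AU[a _ [O UO Ox]]; exists O => //; exists a.
exists (fun a => W `&` U a); split.
  move=> a; split; first exact: subIsetr.
  by apply: finite_set_countable; exact: finite_setIl.
move=> x /AW[O WO Ox]; have [a _ UO] := WU O WO.
by exists a => //; apply: closure_subset Ox => y Oy; exists O.
Qed.
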